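(* Let $d,m,n$ be positive integers satisfying $\operatorname{lcm}(m,n)\cdot \gcd(m,n,d)=\gcd(m,n)\,d$. Then the following construction can be carried out: (i) there are pairwise coprime positive integers $a,b,c$ such that $m=\frac{cd}{a}$ and $n=\frac{cd}{b}$; (ii) there are integers $u,v$ such that $au-bv=c$; (iii) put $x=\frac{du}{b}$ and $y=\frac{dv}{a}$; these are integers and automatically satisfy $d\mid xy$. Moreover, the set of matrices $Z=\begin{pmatrix} z_1&z_2\\ z_2&z_3\end{pmatrix}\in\mathfrak{h}_2$ satisfying $$z_3=(x+y)z_2-xyz_1$$ (a singular relation with $\Delta=\left(\frac{cd}{ab}\right)^2$) maps into an irreducible component of $\mathcal{E}_d(m,n)$.
   Context: All abelian varieties are over $\mathbb{C}$. $\mathcal{A}_2(d)$ is the moduli space of polarised abelian surfaces $(A,\mathcal{L})$ of type $(1,d)$. The exponent of an elliptic curve $E\subseteq A$ is $\deg(\mathcal{L}|_E)$. An elliptic curve $E\subseteq A$ corresponds to a symmetric idempotent $\epsilon_E\in\mathrm{End}(A)\otimes\mathbb{Q}$ (fixed by the Rosati involution) with image $E$; its complementary elliptic curve is $F:=\mathrm{Im}(1-\epsilon_E)$. $\mathcal{E}_d(m,n)$ is the set of $(A,\mathcal{L})\in\mathcal{A}_2(d)$ such that $A$ contains a pair of complementary elliptic curves of exponents $m,n$. $\mathfrak{h}_2$ is the Siegel space of symmetric complex $2\times2$ matrices $Z$ with $\mathrm{Im}(Z)>0$; the map $\mathfrak{h}_2\to\mathcal{A}_2(d)$ sends $Z$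 to $\mathbb{C}^2/(Z\mathbb{Z}^2+D\mathbb{Z}^2)$, $D=\mathrm{diag}(1,d)$, with its standard polarisation of type $(1,d)$. A singular relation is an equation $da_1z_1+a_2z_2+a_3z_3+a_4(z_2^2-z_1z_3)+da_5=0$ with integers $a_1,\dots,a_5$ without a common divisor, and its discriminant is $\Delta=a_2^2-4da_1a_3-4da_4a_5$. *)

(* Defs.v *)
From mathcomp Require Import all_boot all_order all_algebra complex.
From mathcomp Require Import all_classical all_reals all_analysis.
Set Implicit Arguments.
Unset Strict Implicit.
Unset Printing Implicit Defensive.
Import Order.TTheory GRing.Theory Num.Theory numFieldNormedType.Exports.
Local Open Scope classical_set_scope.
Local Open Scope ring_scope.
Local Open Scope complex_scope.

Section Lattices.
Variable R : realType.
Local Notation C := (R[i]).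
Local Notation V := ('cV[C]_2).

Definition real_free (k : nat) (e : 'I_k -> V) : Prop :=
  forall t : 'I_k -> R, \sum_(i < k) (t i)%:C *: e i = 0 -> forall i, t i = 0.

Definition int_span (k : nat) (e : 'I_k -> V) : set V :=
  [set v | exists t : 'I_k -> int, v = \sum_(i < k) (t i)%:~R *: e i].

Definition lattice_basis (k : nat) (e : 'I_k -> V) (L : set V) : Prop :=
  real_free e /\ L = int_span e.

End Lattices.

(* Polarised abelian surfaces. A pair (Lambda, H) stands for the torus
   A = C^2 / Lambda together with the class c_1(L) of a line bundle L, which is
   the hermitian form (v, w) |-> v^T H conj(w), integral on Lambda. A
   polarisation is an ample L up to algebraic equivalence, hence is the same
   as a positive definite such form. *)
Section PolarisedSurfaces.
Variable R : realType.
Local Notation C := (R[i]).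
Local Notation V := ('cV[C]_2).

Record torus_form := TorusForm { lat : set V; herm : 'M[C]_2 }.

Definition hform (A : torus_form) (v w : V) : C :=
  (v^T *m herm A *m map_mx conjc w) 0 0.

Definition alt_form (A : torus_form) (v w : V) : R := complex.Im (hform A v w).

Definition type_mx (d : nat) : 'M[int]_2 :=
  diag_mx (\row_(i < 2) if i == 0 then 1 else d%:Z).

Definition symplectic_mx (d : nat) : 'M[int]_(2 + 2) :=
  block_mx 0 (type_mx d) (- type_mx d) 0.

Definition is_polarised (d : nat) (A : torus_form) : Prop :=
  [/\ forall v w, hform A w v = (hform A v w)^*,
      forall v, v != 0 -> 0 < hform A v v
    & exists e : 'I_(2 + 2) -> V, lattice_basis e (lat A) /\
        forall i j, alt_form A (e i) (e j) = (symplectic_mx d i j)%:~R].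

Definition isomorphic (A B : torus_form) : Prop :=
  exists T : 'M[C]_2, [/\ T \in unitmx,
    lat B = [set T *m v | v in lat A]
  & forall v w, hform B (T *m v) (T *m w) = hform A v w].

Definition iso_class (A : torus_form) : set torus_form :=
  [set B | isomorphic A B].

(* The points of A_2(d) are the isomorphism classes. *)
Definition moduli (d : nat) : set (set torus_form) :=
  [set P | exists A, is_polarised d A /\ P = iso_class A].

(* An elliptic curve E in A is given by its tangent space at 0, a complex line
   W such that W / (W `&` lat A) is compact. *)
Definition elliptic_curve (A : torus_form) (W : set V) : Prop :=
  (exists w : V, w != 0 /\ W = [set t *: w | t in [set: C]]) /\
  exists e : 'I_2 -> V, lattice_basis e (W `&` lat A).

(* deg (L|_E) is the value of the alternating form Im H = c_1(L) on a positively
   oriented basis of the lattice of E. *)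
Definition exponent (A : torus_form) (W : set V) (m : nat) : Prop :=
  exists e : 'I_2 -> V, lattice_basis e (W `&` lat A) /\
    `|alt_form A (e 0) (e 1)| = m%:R.

(* End(A) (x) Q, through the analytic representation. *)
Definition End_rat (A : torus_form) (eps : 'M[C]_2) : Prop :=
  exists N : nat, (0 < N)%N /\
    forall v, lat A v -> lat A (N%:R *: (eps *m v)).

(* The Rosati involution is the adjunction with respect to H. *)
Definition rosati (A : torus_form) (eps eps' : 'M[C]_2) : Prop :=
  forall v w, hform A (eps *m v) w = hform A v (eps' *m w).

Definition symmetric_idempotent (A : torus_form) (eps : 'M[C]_2) : Prop :=
  [/\ End_rat A eps, eps *m eps = eps & rosati A eps eps].

Definition complementary (A : torus_form) (E F : set V) : Prop :=
  exists eps : 'M[C]_2, [/\ symmetric_idempotent A eps,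
    E = range (fun v : V => eps *m v)
  & F = range (fun v : V => (1%:M - eps) *m v)].

(* The locus E_d(m,n). *)
Definition split_locus (d m n : nat) : set (set torus_form) :=
  [set P | exists A, [/\ is_polarised d A, P = iso_class A
   & exists E F : set V,
      [/\ elliptic_curve A E, elliptic_curve A F, complementary A E F,
          exponent A E m & exponent A F n]]].

End PolarisedSurfaces.

Section Siegel.
Variable R : realType.
Local Notation C := (R[i]).

Definition im_mx (Z : 'M[C]_2) : 'M[R]_2 := map_mx (@complex.Im R) Z.

Definition siegel : set 'M[C]_2 :=
  [set Z | Z^T = Z /\
     forall v : 'cV[R]_2, v != 0 -> 0 < (v^T *m im_mx Z *m v) 0 0].

Definition cmx (M : 'M[int]_2) : 'M[C]_2 := map_mx intr M.

(* C^2 / (Z Z^2 + D Z^2), whose standard polarisation is (Im Z)^-1. *)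
Definition std_surface (d : nat) (Z : 'M[C]_2) : torus_form R :=
  TorusForm
    [set v | exists p q : 'cV[int]_2,
       v = Z *m map_mx intr p + cmx (type_mx d) *m map_mx intr q]
    (map_mx (real_complex R) (invmx (im_mx Z))).

Definition period_map (d : nat) (Z : 'M[C]_2) : set (torus_form R) :=
  iso_class (std_surface d Z).

End Siegel.

(* The Zariski topology of A_2(d). By Baily-Borel, A_2(d) = siegel / Gamma_D is
   an open subset of Proj of the graded ring of Siegel modular forms, so its
   closed subsets are the common zero loci of sets of modular forms. *)
Section Zariski.
Variable R : realType.
Local Notation C := (R[i]).

Definition sym2 (z1 z2 z3 : C) : 'M[C]_2 :=
  \matrix_(i < 2, j < 2)
    if i != j then z2 else if i == 0 then z1 else z3.

(* The degree n part of the power series with coefficients a. *)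
Definition homog_part (a : nat -> nat -> nat -> C) (h1 h2 h3 : C) (n : nat)
    : C :=
  \sum_(i < n.+1) \sum_(j < (n - i).+1)
    a i j (n - i - j)%N * h1 ^+ i * h2 ^+ j * h3 ^+ (n - i - j).

Definition homog_norm (a : nat -> nat -> nat -> C) (h1 h2 h3 : C) (n : nat)
    : C :=
  \sum_(i < n.+1) \sum_(j < (n - i).+1)
    `|a i j (n - i - j)%N * h1 ^+ i * h2 ^+ j * h3 ^+ (n - i - j)|.

(* Holomorphy on the Siegel space, an open subset of the space C^3 of symmetric
   matrices: near each point, f is the sum of an absolutely convergent power
   series in the three coordinates. *)
Definition holomorphic (f : 'M[C]_2 -> C) : Prop :=
  forall Z0, siegel Z0 ->
  exists (r : R) (a : nat -> nat -> nat -> C), 0 < r /\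
    forall h1 h2 h3 : C, `|h1| < r%:C -> `|h2| < r%:C -> `|h3| < r%:C ->
      cvgn (series (homog_norm a h1 h2 h3) : nat -> (C : numFieldType)) /\
      (series (homog_part a h1 h2 h3) : nat -> (C : numFieldType)) @ \oo
        --> (f (Z0 + sym2 h1 h2 h3) : (C : numFieldType)).

(* Gamma_D = Sp_4^D(Z), with D = type_mx d: the automorphisms of Z^4 preserving
   the alternating form of type (1,d). *)
Definition Gamma (d : nat) (M : 'M[int]_(2 + 2)) : Prop :=
  M *m symplectic_mx d *m M^T = symplectic_mx d.

(* If M has blocks (alpha, beta; gamma, delta), then
   (alpha, beta D; D^-1 gamma, D^-1 delta D) lies in Sp_4(Q), and Gamma_D acts
   through the usual action of Sp_4(Q); autom_mx is its automorphy factor.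
   As Z is symmetric, (Z, D) M^T = (autom_mx d M Z)^T (siegel_act d M Z, D), so
   the two points have isomorphic surfaces. *)
Definition autom_mx (d : nat) (M : 'M[int]_(2 + 2)) (Z : 'M[C]_2) : 'M[C]_2 :=
  invmx (cmx R (type_mx d)) *m
    (cmx R (dlsubmx M) *m Z + cmx R (drsubmx M) *m cmx R (type_mx d)).

Definition siegel_act (d : nat) (M : 'M[int]_(2 + 2)) (Z : 'M[C]_2)
    : 'M[C]_2 :=
  (cmx R (ulsubmx M) *m Z + cmx R (ursubmx M) *m cmx R (type_mx d))
    *m invmx (autom_mx d M Z).

(* There is no condition at the cusps, by the Koecher principle. *)
Definition modular_form (d k : nat) (f : 'M[C]_2 -> C) : Prop :=
  holomorphic f /\
  forall M Z, Gamma d M -> siegel Z ->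
    f (siegel_act d M Z) = \det (autom_mx d M Z) ^+ k * f Z.

Definition zariski_closed (d : nat) (X : set (set (torus_form R))) : Prop :=
  X `<=` moduli d /\
  exists S : set ('M[C]_2 -> C),
    (forall f, S f -> exists k, modular_form d k f) /\
    forall Z, siegel Z -> (X (period_map d Z) <-> forall f, S f -> f Z = 0).

Definition irreducible (d : nat) (X : set (set (torus_form R))) : Prop :=
  [/\ X `<=` moduli d, X !=set0
    & forall Y1 Y2, zariski_closed d Y1 -> zariski_closed d Y2 ->
        X `<=` Y1 `|` Y2 -> X `<=` Y1 \/ X `<=` Y2].

Definition irreducible_component (d : nat) (E X : set (set (torus_form R)))
    : Prop :=
  [/\ X `<=` E, irreducible d X
    & forall Y, irreducible d Y -> X `<=` Y -> Y `<=` E -> Y = X].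

End Zariski.

Record singular_relation := SingularRelation {
  sr1 : int; sr2 : int; sr3 : int; sr4 : int; sr5 : int;
  sr_primitive : gcdz sr1 (gcdz sr2 (gcdz sr3 (gcdz sr4 sr5))) = 1 }.

Definition singular_lhs (R : realType) (d : nat) (s : singular_relation)
    (Z : 'M[R[i]]_2) : R[i] :=
  let z1 := Z 0 0 in let z2 := Z 0 1 in let z3 := Z 1 1 in
  d%:R * (sr1 s)%:~R * z1 + (sr2 s)%:~R * z2 + (sr3 s)%:~R * z3
  + (sr4 s)%:~R * (z2 ^+ 2 - z1 * z3) + d%:R * (sr5 s)%:~R.

Definition discriminant (d : nat) (s : singular_relation) : int :=
  sr2 s ^+ 2 - 4 * d%:Z * sr1 s * sr3 s - 4 * d%:Z * sr4 s * sr5 s.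

Definition admissible (d m n a b c : nat) : Prop :=
  [/\ [/\ (0 < a)%N, (0 < b)%N & (0 < c)%N],
      [/\ coprime a b, coprime a c & coprime b c],
      m%:R = (c * d)%:R / a%:R :> rat
    & n%:R = (c * d)%:R / b%:R :> rat].

(* Main.v *)
Require Import Defs.
From mathcomp Require Import all_boot all_order all_algebra complex.
From mathcomp Require Import all_classical all_reals all_analysis.
From mathcomp Require Import ring lra.
Set Implicit Arguments.
Unset Strict Implicit.
Unset Printing Implicit Defensive.
Import Order.TTheory GRing.Theory Num.Theory numFieldNormedType.Exports.
Local Open Scope classical_set_scope.
Local Open Scope ring_scope.
Local Open Scope complex_scope.

(** The relation [z_3 = (x+y) z_2 - xy z_1] says exactly that the vectors
    [(1,x)] and [(1,y)] are orthogonal for the quadratic form with matrix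
    [((z_3, - z_2), (- z_2, z_1))], the adjugate of [Z].  Two things follow.

    First, its imaginary part says that the lines [E = C (1,x)] and
    [F = C (1,y)] are orthogonal for the polarisation [(Im Z)^-1].  As [Z (-y,1)]
    is a multiple of [(1,x)], and so is [D (k,u)] when [d = g k] and [x = g u],
    the line [E] meets the lattice in rank two: it is an elliptic curve, of
    exponent [k (x - y)] when [k] and [u] are coprime ([line_lattice_basis],
    [line_exponent]).  The curve [F] is treated by exchanging [x] and [y], and
    the projection onto [E] along [F] is the required symmetric idempotent
    ([lines_complementary]).  The arithmetic condition on [d], [m], [n] means
    that [d = a b e], [m = c b e], [n = c a e] ([admissible_param]); then
    [x = a e u], [y = b e v] and [x - y = e c], and the two exponents come out
    as [m] and [n] ([period_map_split_locus]).

    Second, the relation is linear in [Z], so it cuts a convex subset out of the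
    Siegel space.  The image of a convex set of period matrices is irreducible
    ([period_image_irreducible]): if it lies in the union of two closed sets but
    in neither, there are modular forms [f] and [g] with [f g = 0] on the convex
    set, [f] nonzero at some point of it and [g] nonzero at another; but on the
    segment joining these points [f] and [g] are analytic functions of one real
    variable, and the product of two such functions vanishes only if one of them
    does ([segment_mul_eq0]).  Finally, unions of chains of irreducible sets are
    irreducible, so Zorn's lemma puts every irreducible subset of the locus in a
    component ([irreducible_sub_component]). *)

(** * Arithmetic of admissible triples *)

(** With [g = gcd(m,n)] and [h = gcd(g,d)], the hypothesis reads
    [d = (m/g) (n/g) h]; the triple is [a = n/g], [b = m/g], [c = g/h], and [c]
    is prime to [ab] because [h = gcd(c h, a b h)]. *)
Lemma admissible_exists (d m n : nat) :
  (0 < d)%N -> (0 < m)%N -> (0 < n)%N ->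
  (lcmn m n * gcdn (gcdn m n) d = gcdn m n * d)%N ->
  exists a b c : nat, admissible d m n a b c.
Proof.
move=> d_gt0 m_gt0 n_gt0 hlcm.
set g := gcdn m n in hlcm; set h := gcdn g d in hlcm.
have g_gt0 : (0 < g)%N by rewrite gcdn_gt0 m_gt0.
have h_gt0 : (0 < h)%N by rewrite gcdn_gt0 g_gt0.
have [b mE] : exists b, m = (b * g)%N by apply/dvdnP/dvdn_gcdl.
have [a nE] : exists a, n = (a * g)%N by apply/dvdnP/dvdn_gcdr.
have [c gE] : exists c, g = (c * h)%N by apply/dvdnP/dvdn_gcdl.
have cop_ba : coprime b a.
  by rewrite /coprime -(eqn_pmul2r g_gt0) muln_gcdl -mE -nE mul1n.
have dE : d = (a * b * h)%N.
  apply/eqP; rewrite -(eqn_pmul2l g_gt0) -hlcm -(eqn_pmul2l g_gt0).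
  apply/eqP; transitivity (m * n * h)%N; last by rewrite mE nE; ring.
  by rewrite -(muln_lcm_gcd m n) -/g; ring.
have cop_c : coprime c (a * b).
  by rewrite /coprime -(eqn_pmul2r h_gt0) muln_gcdl -gE -dE mul1n.
have [a_gt0 b_gt0 c_gt0] : [/\ 0 < a, 0 < b & 0 < c]%N.
  by move: m_gt0 n_gt0 g_gt0; rewrite mE nE gE !muln_gt0;
    move=> /andP[-> _] /andP[-> _] /andP[-> _].
move: cop_c; rewrite coprimeMr => /andP[cop_ca cop_cb].
exists a, b, c; split.
- by [].
- by rewrite coprime_sym cop_ba coprime_sym cop_ca coprime_sym cop_cb.
- apply: (canRL (mulfK _)); first by rewrite pnatr_eq0 -lt0n.
  by rewrite -natrM mE gE dE; congr (_ %:R); ring.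
- apply: (canRL (mulfK _)); first by rewrite pnatr_eq0 -lt0n.
  by rewrite -natrM nE gE dE; congr (_ %:R); ring.
Qed.

(** Coprimality forces [a] and [b] to divide [d], so the fractions that define
    an admissible triple turn into this parametrisation by integers, which is
    what the geometry uses. *)
Lemma admissible_param (d m n a b c : nat) :
  (0 < d)%N -> admissible d m n a b c ->
  exists2 e, (0 < e)%N &
    [/\ d = (a * b * e)%N, m = (c * b * e)%N & n = (c * a * e)%N].
Proof.
move=> d_gt0 [[a_gt0 b_gt0 c_gt0] [cop_ab cop_ac cop_bc] mE nE].
have {mE} mE : (m * a = c * d)%N.
  have : (m * a)%:R = (c * d)%:R :> rat.
    by rewrite natrM mE mulfVK // pnatr_eq0 -lt0n.
  by move/eqP; rewrite eqr_nat => /eqP.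
have {nE} nE : (n * b = c * d)%N.
  have : (n * b)%:R = (c * d)%:R :> rat.
    by rewrite natrM nE mulfVK // pnatr_eq0 -lt0n.
  by move/eqP; rewrite eqr_nat => /eqP.
have a_dvd : (a %| d)%N by rewrite -(Gauss_dvdr _ cop_ac) -mE dvdn_mull.
have b_dvd : (b %| d)%N by rewrite -(Gauss_dvdr _ cop_bc) -nE dvdn_mull.
have /dvdnP[e dE] : (a * b %| d)%N by rewrite Gauss_dvd // a_dvd.
exists e; first by move: d_gt0; rewrite dE muln_gt0 => /andP[].
split; first by rewrite dE mulnC.
- by apply/eqP; rewrite -(eqn_pmul2r a_gt0) mE dE; apply/eqP; ring.
- by apply/eqP; rewrite -(eqn_pmul2r b_gt0) nE dE; apply/eqP; ring.
Qed.

(** * The standard polarised surface of a period matrix *)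

Lemma sum_ord2 (V : nmodType) (F : 'I_2 -> V) : \sum_(i < 2) F i = F 0 + F 1.
Proof.
by rewrite !big_ord_recl big_ord0 addr0; congr (_ + F _); apply/val_inj.
Qed.

Lemma ord2P (i : 'I_2) : i = 0 \/ i = 1.
Proof. by case: i => [[|[|]]] // ?; [left|right]; apply/val_inj. Qed.

Lemma cV2_eq (K : Type) (v w : 'cV[K]_2) :
  v 0 0 = w 0 0 -> v 1 0 = w 1 0 -> v = w.
Proof.
move=> e0 e1; apply/matrixP => i j; rewrite (ord1 j).
by case: (ord2P i) => ->.
Qed.

Lemma mulmx2E (K : pzSemiRingType) (M : 'M[K]_2) (v : 'cV[K]_2) i :
  (M *m v) i 0 = M i 0 * v 0 0 + M i 1 * v 1 0.
Proof. by rewrite mxE sum_ord2. Qed.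

Section SiegelSurface.
Variable R : realType.
Local Notation C := (R[i]).

Lemma Im_cmul (t : R) (z : C) : complex.Im (t%:C * z) = t * complex.Im z.
Proof. by case: z => a b; simpc. Qed.

Lemma intr_complex (k : int) : (k%:~R : C) = (k%:~R : R)%:C.
Proof. by rewrite rmorph_int. Qed.

Definition det_im (Z : 'M[C]_2) : R :=
  complex.Im (Z 0 0) * complex.Im (Z 1 1) - complex.Im (Z 0 1) ^+ 2.

Lemma quad_im (Z : 'M[C]_2) (v : 'cV[R]_2) : Z 1 0 = Z 0 1 ->
  (v^T *m im_mx Z *m v) 0 0 =
    complex.Im (Z 0 0) * v 0 0 ^+ 2 + complex.Im (Z 0 1) * v 0 0 * v 1 0 *+ 2
    + complex.Im (Z 1 1) * v 1 0 ^+ 2.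
Proof. by move=> sZ; rewrite mxE sum_ord2 !mxE !sum_ord2 !mxE sZ; ring. Qed.

Lemma quad_gt0 (y1 y2 y3 s t : R) : 0 < y1 -> 0 < y1 * y3 - y2 ^+ 2 ->
  (s != 0) || (t != 0) -> 0 < y1 * s ^+ 2 + y2 * s * t *+ 2 + y3 * t ^+ 2.
Proof.
move=> y1_gt0 det_gt0 st_neq0; rewrite -(pmulr_rgt0 _ y1_gt0).
rewrite [ltRHS](_ : _ = (y1 * s + y2 * t) ^+ 2
                        + (y1 * y3 - y2 ^+ 2) * t ^+ 2); last by ring.
have [t0|t_neq0] := eqVneq t 0.
  rewrite t0 eqxx orbF in st_neq0.
  rewrite t0 mulr0 addr0 expr0n mulr0 addr0.
  by rewrite exprn_even_gt0 //= mulf_neq0 // gt_eqF.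
by rewrite ltr_wpDl ?sqr_ge0 // mulr_gt0 // exprn_even_gt0.
Qed.

Lemma quad_ge0 (y1 y2 y3 s t : R) : 0 < y1 -> 0 < y1 * y3 - y2 ^+ 2 ->
  0 <= y1 * s ^+ 2 + y2 * s * t *+ 2 + y3 * t ^+ 2.
Proof.
move=> y1_gt0 det_gt0.
have [st_neq0|] := boolP ((s != 0) || (t != 0)); first by rewrite ltW ?quad_gt0.
rewrite negb_or !negbK => /andP[/eqP -> /eqP ->].
by rewrite !(mulr0, expr0n, mul0rn, addr0).
Qed.

(** Sylvester's criterion in size two. *)
Lemma siegelP (Z : 'M[C]_2) :
  siegel Z <-> [/\ Z 1 0 = Z 0 1, 0 < complex.Im (Z 0 0) & 0 < det_im Z].
Proof.
split=> [[symZ posZ]|[sZ y1_gt0 det_gt0]].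
  have sZ : Z 1 0 = Z 0 1 by rewrite -[in LHS]symZ mxE.
  have y1_gt0 : 0 < complex.Im (Z 0 0).
    have := posZ (\col_i (i == 0)%:R); rewrite quad_im // !mxE /=.
    rewrite !(mulr0, mulr1, expr0n, expr1n, addr0, mul0rn) /=; apply.
    by apply/eqP => /matrixP/(_ 0 0)/eqP; rewrite !mxE eqxx oner_eq0.
  split=> //.
  pose v : 'cV[R]_2 := \col_i (if i == 0 then - complex.Im (Z 0 1)
                               else complex.Im (Z 0 0)).
  have := posZ v; rewrite quad_im // !mxE /=.
  rewrite -(pmulr_rgt0 (det_im Z) y1_gt0).
  have -> : v != 0.
    apply/eqP => /matrixP/(_ 1 0)/eqP; rewrite !mxE /= => y10.
    by rewrite (eqP y10) ltxx in y1_gt0.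
  by move/(_ isT); congr (_ < _); rewrite /det_im; ring.
split.
  apply/matrixP => i j; rewrite mxE.
  by case: (ord2P i) => ->; case: (ord2P j) => ->.
move=> v v_neq0; rewrite quad_im // quad_gt0 //.
apply: contraNT v_neq0; rewrite negb_or !negbK => /andP[/eqP v0 /eqP v1].
by apply/eqP/cV2_eq; rewrite mxE.
Qed.

Lemma invmx_im (Z : 'M[C]_2) : siegel Z ->
  invmx (im_mx Z) = (det_im Z)^-1 *: \matrix_(i, j)
    if i != j then - complex.Im (Z 0 1)
    else if i == 0 then complex.Im (Z 1 1) else complex.Im (Z 0 0).
Proof.
move=> /siegelP[sZ _ det_gt0]; set M := RHS.
have YM : im_mx Z *m M = 1%:M.
  apply/matrixP => i j; rewrite mxE sum_ord2 !mxE.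
  have det_neq0 : det_im Z != 0 by rewrite gt_eqF.
  case: (ord2P i) => ->; case: (ord2P j) => -> /=;
    rewrite ?sZ /det_im in det_neq0 *; by field.
have [unitY _] := mulmx1_unit YM.
by rewrite -[RHS](mulKmx unitY) YM mulmx1.
Qed.

Lemma hform_std (d : nat) (Z : 'M[C]_2) (v w : 'cV[C]_2) : siegel Z ->
  hform (std_surface d Z) v w = ((det_im Z)^-1)%:C *
    ((complex.Im (Z 1 1))%:C * (v 0 0 * (w 0 0)^*)
     - (complex.Im (Z 0 1))%:C * (v 0 0 * (w 1 0)^* + v 1 0 * (w 0 0)^*)
     + (complex.Im (Z 0 0))%:C * (v 1 0 * (w 1 0)^*)).
Proof.
move=> sZ; rewrite /hform /= invmx_im // mxE sum_ord2 !mxE !sum_ord2 !mxE /=.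
by rewrite !rmorphM !rmorphN; ring.
Qed.

Lemma natr_complex (k : nat) : (k%:R : C) = (k%:R : R)%:C.
Proof. by rewrite rmorph_nat. Qed.

Definition period_basis (d : nat) (Z : 'M[C]_2) (i : 'I_(2 + 2)) : 'cV[C]_2 :=
  col i (row_mx Z (cmx R (type_mx d))).

Lemma cmx_type_mulE (d : nat) (q : 'cV[C]_2) :
  ((cmx R (type_mx d) *m q) 0 0 = q 0 0) *
  ((cmx R (type_mx d) *m q) 1 0 = d%:R * q 1 0).
Proof.
rewrite !mulmx2E !mxE /= !(mulr1n, mulr0n).
by rewrite rmorph0 rmorph1 !mul0r mul1r addr0 add0r -pmulrn.
Qed.

Lemma type_mxE (d : nat) (i j : 'I_2) :
  type_mx d i j = if i == j then (if i == 0 then 1 else d%:Z) else 0.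
Proof. by rewrite !mxE; case: (i == j). Qed.

Lemma period_basis_sum (d : nat) (Z : 'M[C]_2) (t : 'I_(2 + 2) -> C) :
  \sum_i t i *: period_basis d Z i =
    Z *m (\col_i t (lshift 2 i)) + cmx R (type_mx d) *m (\col_i t (rshift 2 i)).
Proof.
rewrite -mul_row_col; apply/matrixP => i j; rewrite (ord1 j) summxE mxE.
apply: eq_bigr => k _; rewrite !mxE mulrC; congr (_ * _).
by case: (split_ordP k) => k' ->; rewrite mxE.
Qed.

(** Every vector is [Z p + D q] for unique real [p] and [q]: in these coordinates
    the polarisation becomes the alternating form of type [(1,d)]. *)
Definition period (d : nat) (Z : 'M[C]_2) (p q : 'cV[R]_2) : 'cV[C]_2 :=
  Z *m map_mx (real_complex R) p
    + cmx R (type_mx d) *m map_mx (real_complex R) q.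

Lemma periodE (d : nat) (Z : 'M[C]_2) (p q : 'cV[R]_2) : siegel Z ->
  (period d Z p q 0 0
    = Z 0 0 * (p 0 0)%:C + Z 0 1 * (p 1 0)%:C + (q 0 0)%:C) *
  (period d Z p q 1 0
    = Z 0 1 * (p 0 0)%:C + Z 1 1 * (p 1 0)%:C + d%:R * (q 1 0)%:C).
Proof.
move=> /siegelP[sZ _ _]; rewrite /period; split;
by rewrite [LHS]mxE cmx_type_mulE mulmx2E !mxE ?sZ.
Qed.

Lemma period_basis_real_sum (d : nat) (Z : 'M[C]_2) (t : 'I_(2 + 2) -> R) :
  \sum_i (t i)%:C *: period_basis d Z i =
    period d Z (\col_i t (lshift 2 i)) (\col_i t (rshift 2 i)).
Proof.
rewrite period_basis_sum; congr (_ + _); congr (_ *m _);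
by apply/matrixP => i j; rewrite !mxE.
Qed.

Lemma lat_stdP (d : nat) (Z : 'M[C]_2) (v : 'cV[C]_2) :
  lat (std_surface d Z) v <->
  exists p q : 'cV[int]_2, v = period d Z (map_mx intr p) (map_mx intr q).
Proof.
split=> -[p [q ->]]; exists p, q; congr (_ + _); congr (_ *m _);
by apply/matrixP => i j; rewrite !mxE intr_complex.
Qed.

Lemma period_basisE (d : nat) (Z : 'M[C]_2) (k : 'I_2) :
  (period_basis d Z (lshift 2 k) = period d Z (delta_mx k 0) 0) *
  (period_basis d Z (rshift 2 k) = period d Z 0 (delta_mx k 0)).
Proof.
by rewrite /period_basis /period colKl colKr !map_mx0 !mulmx0 addr0 add0r
  !map_delta_mx !colE.
Qed.

(** The columns of [(Z, D)] are independent over the reals: the imaginary part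
    of [Z p + D q] is [(Im Z) p], and [Im Z] is invertible. *)
Lemma period_eq0 (d : nat) (Z : 'M[C]_2) (p q : 'cV[R]_2) :
  (0 < d)%N -> siegel Z -> period d Z p q = 0 -> p = 0 /\ q = 0.
Proof.
move=> d_gt0 sZ eq0; have /siegelP[_ y1_gt0 det_gt0] := sZ.
have d_neq0 : d%:R != 0 :> R by rewrite pnatr_eq0 -lt0n.
move/matrixP: eq0 => eq0; have := eq0 1 0; have := eq0 0 0.
rewrite !periodE // !mxE.
move: y1_gt0 det_gt0; rewrite /det_im natr_complex.
case: (Z 0 0) => x1 y1; case: (Z 0 1) => x2 y2; case: (Z 1 1) => x3 y3 /=.
simpc => y1_gt0 det_gt0 [e0x e0y] [e1x e1y].
have p0 : p 0 0 = 0.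
  have : (y1 * y3 - y2 ^+ 2) * p 0 0 = 0.
    transitivity (y3 * (y1 * p 0 0 + y2 * p 1 0)
                  - y2 * (y2 * p 0 0 + y3 * p 1 0)); first by ring.
    by rewrite e0y e1y !mulr0 subr0.
  by move/eqP; rewrite mulf_eq0 gt_eqF //= => /eqP.
have p1 : p 1 0 = 0.
  have : (y1 * y3 - y2 ^+ 2) * p 1 0 = 0.
    transitivity (y1 * (y2 * p 0 0 + y3 * p 1 0)
                  - y2 * (y1 * p 0 0 + y2 * p 1 0)); first by ring.
    by rewrite e0y e1y !mulr0 subr0.
  by move/eqP; rewrite mulf_eq0 gt_eqF //= => /eqP.
move: e0x e1x; rewrite p0 p1 !mulr0 !add0r => q0 /eqP.
rewrite mulf_eq0 (negPf d_neq0) /= => /eqP q1.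
by split; apply/cV2_eq; rewrite mxE.
Qed.

(** The inverse of [Im Z] is chosen so that the real part of [Z] cancels: for
    [Z = X + i Y] the value on the columns of [Z] is the imaginary part of
    [(X + i Y) Y^-1 (X - i Y)], which is real, and on a column of [Z] and one of
    [D] it is that of [(X + i Y) Y^-1 D], namely [D]. *)
Lemma alt_form_period (d : nat) (Z : 'M[C]_2) (p q p' q' : 'cV[R]_2) :
  siegel Z ->
  alt_form (std_surface d Z) (period d Z p q) (period d Z p' q') =
    p 0 0 * q' 0 0 - q 0 0 * p' 0 0
    + d%:R * (p 1 0 * q' 1 0 - q 1 0 * p' 1 0).
Proof.
move=> sZ; rewrite /alt_form hform_std // !periodE //.
have /siegelP[_ _] := sZ; rewrite /det_im natr_complex.
case: (Z 0 0) => x1 y1; case: (Z 0 1) => x2 y2; case: (Z 1 1) => x3 y3 /=.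
by simpc => /= det_gt0; field; rewrite gt_eqF.
Qed.

Lemma std_polarised (d : nat) (Z : 'M[C]_2) :
  (0 < d)%N -> siegel Z -> is_polarised d (std_surface d Z).
Proof.
move=> d_gt0 sZ; have [symZ y1_gt0 det_gt0] := (siegelP Z).1 sZ; split.
- move=> v w; rewrite !hform_std //.
  case: (v 0 0) (v 1 0) (w 0 0) (w 1 0) => [v0 v0'] [v1 v1'] [w0 w0'] [w1 w1'].
  by simpc; congr (_ +i* _); ring.
- move=> v v_neq0; rewrite hform_std //.
  have v_neq0' : (v 0 0 != 0) || (v 1 0 != 0).
    apply: contraNT v_neq0; rewrite negb_or !negbK => /andP[/eqP v0 /eqP v1].
    by apply/eqP/cV2_eq; rewrite mxE.
  move: y1_gt0 det_gt0 v_neq0'; rewrite /det_im.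
  case: (Z 0 0) => x1 y1; case: (Z 0 1) => x2 y2; case: (Z 1 1) => x3 y3 /=.
  rewrite !eq_complex.
  case: (v 0 0) (v 1 0) => [a a'] [b b'] /=; simpc.
  move=> y1_gt0 det_gt0 v_neq0'; apply/andP; split; first by apply/eqP; ring.
  rewrite mulr_gt0 ?invr_gt0 //.
  rewrite [ltRHS](_ : _ =
    (y1 * (- b) ^+ 2 + y2 * (- b) * a *+ 2 + y3 * a ^+ 2)
    + (y1 * (- b') ^+ 2 + y2 * (- b') * a' *+ 2 + y3 * a' ^+ 2)); last by ring.
  have [ab0|ab_neq0] := boolP ((b == 0) && (a == 0)).
    move: v_neq0'; case/andP: (ab0) => /eqP -> /eqP ->.
    rewrite eqxx /= oppr0 => v_neq0'.
    by rewrite ltr_wpDl ?quad_gt0 ?oppr_eq0 1?orbC // !(mulr0, expr0n, mul0rn, addr0).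
  by rewrite ltr_pwDl ?quad_ge0 // quad_gt0 // oppr_eq0 -negb_and.
- exists (period_basis d Z); split; first split.
  + move=> t; rewrite period_basis_real_sum => /(period_eq0 d_gt0 sZ)[p0 q0] i.
    case: (split_ordP i) => k ->.
      by move/matrixP/(_ k 0): p0; rewrite !mxE.
    by move/matrixP/(_ k 0): q0; rewrite !mxE.
  + apply/seteqP; split=> v /=.
      move=> [p [q ->]]; exists (fun i => col_mx p q i 0).
      rewrite period_basis_sum; congr (_ + _); congr (_ *m _);
      by apply/matrixP => i j; rewrite (ord1 j) [LHS]mxE [RHS]mxE ?col_mxEu ?col_mxEd.
    move=> [t ->]; exists (\col_i t (lshift 2 i)), (\col_i t (rshift 2 i)).
    by rewrite period_basis_sum; congr (_ + _); congr (_ *m _);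
       apply/matrixP => i j; rewrite !mxE.
  + move=> i j; case: (split_ordP i) => k ->; case: (split_ordP j) => l ->;
    rewrite !period_basisE alt_form_period // /symplectic_mx
      ?(block_mxEul, block_mxEur, block_mxEdl, block_mxEdr) ?[(- _) _ _]mxE
      ?type_mxE !mxE;
    case: (ord2P k) => ->; case: (ord2P l) => -> /=;
    rewrite ?(mulr0, mul0r, mulr1, subr0, sub0r, oppr0, addr0, add0r) //.
by rewrite mulrN1 mulr1n rmorphN /= -pmulrn.
Qed.

End SiegelSurface.

(** * Elliptic curves cut out by rational lines *)

Section Lines.
Variable R : realType.
Local Notation C := (R[i]).

Lemma cV_comb2E (s t : C) (v w : 'cV[C]_2) i :
  (s *: v + t *: w) i 0 = s * v i 0 + t * w i 0.
Proof. by rewrite !mxE. Qed.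

Lemma cV_subE (v w : 'cV[C]_2) i : (v - w) i 0 = v i 0 - w i 0.
Proof. by rewrite !mxE. Qed.

Definition line (x : int) : set 'cV[C]_2 :=
  [set v | v 1 0 = x%:~R * v 0 0].

(** Under the relation, [det (Im Z)] factors through the slopes [x] and [y];
    as it is positive, neither factor vanishes, which makes the bases below
    independent over the reals. *)
Lemma split_relation (x y : int) (Z : 'M[C]_2) :
  siegel Z -> Z 1 1 = (x + y)%:~R * Z 0 1 - (x * y)%:~R * Z 0 0 ->
  (det_im Z = (complex.Im (Z 0 1) - x%:~R * complex.Im (Z 0 0))
              * (y%:~R * complex.Im (Z 0 0) - complex.Im (Z 0 1))) *
  (complex.Im (Z 0 1) - x%:~R * complex.Im (Z 0 0) != 0) *
  (complex.Im (Z 0 1) - y%:~R * complex.Im (Z 0 0) != 0).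
Proof.
move=> /siegelP[_ _ det_gt0] rel.
have detE : det_im Z = (complex.Im (Z 0 1) - x%:~R * complex.Im (Z 0 0))
              * (y%:~R * complex.Im (Z 0 0) - complex.Im (Z 0 1)).
  by rewrite /det_im rel raddfB /= !intr_complex !Im_cmul rmorphM rmorphD /=; ring.
have := gt_eqF det_gt0; rewrite detE => /negbT.
by rewrite mulf_eq0 negb_or -[_ - complex.Im _]opprB oppr_eq0 => /andP[-> ->].
Qed.

(** The lattice vectors [Z (-y,1)] and [D (k,u)]: by the relation
    [z_3 = (x+y) z_2 - xy z_1], with [x = g u] and [d = g k], they are
    [z_2 - y z_1] and [k] times [(1,x)]. *)
Definition line_basis (d k : nat) (u y : int) (Z : 'M[C]_2) (i : 'I_2)
    : 'cV[C]_2 :=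
  if i == 0 then
    period d Z (\col_i (if i == 0 then - y%:~R else 1)) 0
  else
    period d Z 0 (\col_i (if i == 0 then k%:R else u%:~R)).

Section Curve.
Variables (d g k : nat) (u y : int) (Z : 'M[C]_2).
Hypotheses (k_gt0 : (0 < k)%N) (dE : d = (g * k)%N) (g_gt0 : (0 < g)%N).
Hypothesis cop : coprimez k u.
Hypothesis sZ : siegel Z.
Local Notation x := (g%:Z * u).
Hypothesis rel : Z 1 1 = (x + y)%:~R * Z 0 1 - (x * y)%:~R * Z 0 0.

Lemma line_basisE :
  (line_basis d k u y Z 0 0 0 = Z 0 1 - y%:~R * Z 0 0) *
  (line_basis d k u y Z 0 1 0 = x%:~R * (Z 0 1 - y%:~R * Z 0 0)) *
  (line_basis d k u y Z 1 0 0 = k%:R) *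
  (line_basis d k u y Z 1 1 0 = x%:~R * k%:R).
Proof.
rewrite /line_basis /= !periodE // !mxE /= rel dE.
rewrite !(rmorphN, rmorph0, rmorph1, rmorph_nat, rmorph_int, rmorphM, rmorphD) /=.
by do !split; rewrite ?natrM ?pmulrn; ring.
Qed.

(** A lattice vector [Z p + D q] lies on the line when
    [(z_2 - x z_1) (p_1 + y p_2) + g (k q_2 - u q_1) = 0].  As [z_2 - x z_1] is
    not real, both terms vanish; then [p] is a multiple of [(-y,1)] and, [k] and
    [u] being coprime, [q] is a multiple of [(k,u)]. *)
Lemma line_lattice_basis :
  lattice_basis (line_basis d k u y Z) (line x `&` lat (std_surface d Z)).
Proof.
have [[_ nzx] nzy] := split_relation sZ rel.
split.
  move=> t; rewrite sum_ord2 => /matrixP/(_ 0 0).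
  rewrite cV_comb2E !line_basisE [RHS]mxE => eq0.
  have t0 : t 0 = 0.
    have /(congr1 (@complex.Im R)) := eq0.
    rewrite natr_complex intr_complex; move: nzy.
    case: (Z 0 0) => x1 y1; case: (Z 0 1) => x2 y2.
    simpc => /= nzy /eqP; rewrite mulf_eq0 (negPf nzy) orbF.
    by move/eqP.
  have t1 : t 1 = 0.
    move/eqP: eq0; rewrite t0 rmorph0 mul0r add0r natr_complex -rmorphM fmorph_eq0.
    by rewrite mulf_eq0 pnatr_eq0 -leqn0 leqNgt k_gt0 orbF => /eqP.
  by move=> i; case: (ord2P i) => ->.
apply/seteqP; split=> v /=.
  move=> [vx /lat_stdP[p [q vE]]].
  have [d0 d1] : p 0 0 = - y * p 1 0 /\ k%:Z * q 1 0 = u * q 0 0.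
    move: vx; rewrite /line /= vE !periodE // !mxE rel => eqv.
    have {eqv} : (Z 0 1 - x%:~R * Z 0 0) * (p 0 0 + y * p 1 0)%:~R
                 + (g%:Z * (k%:Z * q 1 0 - u * q 0 0))%:~R = 0.
      move/eqP: eqv; rewrite -subr_eq0 => /eqP <-.
      rewrite dE natrM !(rmorphM, rmorphD, rmorphN, rmorph_int) /=.
      by rewrite -!pmulrn; ring.
    rewrite !(intr_complex _ x) !(intr_complex _ (_ + y * _)).
    rewrite (intr_complex _ (_ * (_ - _))).
    move: nzx; case: (Z 0 0) => x1 y1; case: (Z 0 1) => x2 y2.
    simpc => /= nzx [eqr /eqP].
    rewrite mulf_eq0 (negPf nzx) /= intr_eq0 => /eqP py.
    move: eqr; rewrite py mulr0 add0r => /eqP; rewrite intr_eq0.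
    rewrite mulf_eq0 eqz_nat -leqn0 leqNgt g_gt0 /= subr_eq0 => /eqP ->.
    split=> //; by apply/eqP; rewrite -subr_eq0 opprK py.
  have [[s t] /= bez] := coprimezP _ _ cop.
  pose l := s * q 0 0 + t * q 1 0.
  have l0 : q 0 0 = k%:Z * l.
    rewrite /l mulrDr [k%:Z * (t * _)]mulrCA d1 -[LHS]mul1r -bez; ring.
  have l1 : q 1 0 = u * l.
    rewrite /l mulrDr [u * (s * _)]mulrCA -d1 -[LHS]mul1r -bez; ring.
  clearbody l; exists (fun i => if i == 0 then p 1 0 else l).
  rewrite sum_ord2 /= vE.
  apply/cV2_eq; rewrite cV_comb2E !line_basisE !periodE // !mxE -!intr_complex d0 ?l0 ?l1.
    by rewrite !(rmorphM, rmorphN) /= -!pmulrn; ring.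
  by rewrite rel dE natrM !(rmorphM, rmorphN, rmorphD) /= -!pmulrn; ring.
move=> [t ->]; split.
  by rewrite /line /= sum_ord2 !cV_comb2E !line_basisE; ring.
apply/lat_stdP.
exists (\col_i (t 0 * if i == 0 then - y else 1)),
  (\col_i (t 1 * if i == 0 then k%:Z else u)).
rewrite sum_ord2; apply/cV2_eq;
  rewrite cV_comb2E !line_basisE !periodE // !mxE -!intr_complex /= mulr1.
  by rewrite !(rmorphM, rmorphN) /= -!pmulrn; ring.
by rewrite rel dE natrM !(rmorphM, rmorphN, rmorphD) /= -!pmulrn; ring.
Qed.

Lemma line_elliptic_curve : elliptic_curve (std_surface d Z) (line x).
Proof.
split; last by exists (line_basis d k u y Z); apply: line_lattice_basis.
exists (\col_i (if i == 0 then 1 else x%:~R)); split.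
  by apply/eqP => /matrixP/(_ 0 0)/eqP; rewrite !mxE /= oner_eq0.
apply/seteqP; split=> v /=.
  move=> vx; exists (v 0 0) => //.
  by apply/cV2_eq; rewrite !mxE /= ?mulr1 // mulrC vx.
by move=> [t _ <-]; rewrite /line /= !mxE /= mulr1 mulrC.
Qed.

Lemma line_exponent (m : nat) : m%:Z = `|k%:Z * (x - y)| ->
  exponent (std_surface d Z) (line x) m.
Proof.
move=> mE; exists (line_basis d k u y Z); split; first exact: line_lattice_basis.
rewrite alt_form_period // !mxE /= [m%:R]pmulrn mE intr_norm; congr `|_|.
by rewrite dE natrM !(rmorphM, rmorphN, rmorphD) /= -!pmulrn; ring.
Qed.
End Curve.

(** The pairing of [(1,x)] with [(1,y)] is the imaginary part of the relation,
    divided by [det (Im Z)]. *)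
Lemma line_hform_orthogonal (d : nat) (x y : int) (Z : 'M[C]_2) v w :
  siegel Z -> Z 1 1 = (x + y)%:~R * Z 0 1 - (x * y)%:~R * Z 0 0 ->
  line x v -> line y w -> hform (std_surface d Z) v w = 0.
Proof.
move=> sZ rel vx wy; have /(congr1 (@complex.Im R)) := rel.
rewrite raddfB /= !intr_complex !Im_cmul => im_rel.
rewrite hform_std // vx wy im_rel.
by rewrite !(rmorphM, rmorphD, rmorphB, rmorph_int) /=; ring.
Qed.

End Lines.
Arguments line {R} x.

(** * Complementary elliptic curves *)

Section Complement.
Variable R : realType.
Local Notation C := (R[i]).

Definition line_proj (x y : int) : 'M[C]_2 :=
  (x - y)%:~R^-1 *: \matrix_(i, j)
    ((if i == 0 then 1 else x%:~R) * (if j == 0 then - y%:~R else 1)).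

Section Projection.
Variables (x y : int).
Hypothesis neq_xy : x != y.

Let dxy_neq0 : x%:~R - y%:~R != 0 :> C.
Proof. by rewrite -rmorphB /= intr_eq0 subr_eq0. Qed.

Lemma line_projE (v : 'cV[C]_2) :
  ((line_proj x y *m v) 0 0 = (v 1 0 - y%:~R * v 0 0) / (x%:~R - y%:~R)) *
  ((line_proj x y *m v) 1 0
     = x%:~R * ((v 1 0 - y%:~R * v 0 0) / (x%:~R - y%:~R))).
Proof. by rewrite !mulmx2E !mxE /= rmorphB /=; split; ring. Qed.

Lemma line_coprojE (v : 'cV[C]_2) :
  (((1%:M - line_proj x y) *m v) 0 0
     = (x%:~R * v 0 0 - v 1 0) / (x%:~R - y%:~R)) *
  (((1%:M - line_proj x y) *m v) 1 0
     = y%:~R * ((x%:~R * v 0 0 - v 1 0) / (x%:~R - y%:~R))).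
Proof.
by rewrite mulmxBl mul1mx; split; rewrite cV_subE !line_projE; field.
Qed.

Lemma range_line_proj :
  line x = range (fun v : 'cV[C]_2 => line_proj x y *m v).
Proof.
apply/seteqP; split=> v /=; last by move=> [w _ <-]; rewrite /line /= !line_projE.
by move=> vx; exists v => //; apply/cV2_eq; rewrite !line_projE vx; field.
Qed.

Lemma range_line_coproj :
  line y = range (fun v : 'cV[C]_2 => (1%:M - line_proj x y) *m v).
Proof.
apply/seteqP; split=> v /=; last by move=> [w _ <-]; rewrite /line /= !line_coprojE.
by move=> vy; exists v => //; apply/cV2_eq; rewrite !line_coprojE vy; field.
Qed.

Lemma line_proj_idem : line_proj x y *m line_proj x y = line_proj x y.
Proof.
apply/matrixP => i j; rewrite mxE sum_ord2 !mxE rmorphB /=.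
by case: (ord2P i) => ->; case: (ord2P j) => -> /=; field.
Qed.

(** The factor [x - y] clears the denominator of the projection, and [d] makes
    [D Z^2], hence the lattice, contain the multiples of [(1,x)] that arise. *)
Lemma line_proj_lattice (d : nat) (Z : 'M[C]_2) (v : 'cV[C]_2) : siegel Z ->
  Z 1 1 = (x + y)%:~R * Z 0 1 - (x * y)%:~R * Z 0 0 ->
  lat (std_surface d Z) v ->
  lat (std_surface d Z) ((d%:Z * (x - y))%:~R *: (line_proj x y *m v)).
Proof.
move=> sZ rel /lat_stdP[p [q ->]]; apply/lat_stdP.
exists (\col_i ((d%:Z * (p 0 0 + x * p 1 0)) * if i == 0 then - y else 1)),
  (\col_i ((d%:Z * q 1 0 - y * q 0 0) * if i == 0 then d%:Z else x)).
apply/cV2_eq; rewrite [LHS]mxE line_projE !periodE // !mxE /= -!intr_complex rel;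
by rewrite !(rmorphM, rmorphN, rmorphD, rmorphB) /= -!pmulrn; field.
Qed.

(** An idempotent is self-adjoint when its image is orthogonal to its kernel. *)
Lemma line_proj_selfadjoint (d : nat) (Z : 'M[C]_2) : siegel Z ->
  Z 1 1 = (x + y)%:~R * Z 0 1 - (x * y)%:~R * Z 0 0 ->
  rosati (std_surface d Z) (line_proj x y) (line_proj x y).
Proof.
move=> sZ rel v w; set P := line_proj x y.
have hD a b c : hform (std_surface d Z) (a + b) c
    = hform (std_surface d Z) a c + hform (std_surface d Z) b c.
  by rewrite /hform linearD /= !mulmxDl mxE.
have hD' a b c : hform (std_surface d Z) a (b + c)
    = hform (std_surface d Z) a b + hform (std_surface d Z) a c.
  by rewrite /hform map_mxD mulmxDr mxE.
have Pl a : line x (P *m a) by rewrite /line /= !line_projE.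
have Ql a : line y ((1%:M - P) *m a) by rewrite /line /= !line_coprojE.
have split_PQ a : a = P *m a + (1%:M - P) *m a.
  by rewrite -mulmxDl addrCA subrr addr0 mul1mx.
rewrite {1}[w]split_PQ {2}[v]split_PQ hD hD'.
rewrite (line_hform_orthogonal d sZ rel (Pl v) (Ql w)).
rewrite (@line_hform_orthogonal _ d _ _ _ _ _ sZ _ (Ql v) (Pl w)) ?addr0 //.
by rewrite [y + x]addrC [y * x]mulrC.
Qed.

End Projection.

Lemma lines_complementary (d : nat) (x y : int) (Z : 'M[C]_2) :
  (0 < d)%N -> y < x -> siegel Z ->
  Z 1 1 = (x + y)%:~R * Z 0 1 - (x * y)%:~R * Z 0 0 ->
  complementary (std_surface d Z) (line x) (line y).
Proof.
move=> d_gt0 lt_yx sZ rel; have neq_xy : x != y by rewrite gt_eqF.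
exists (line_proj x y); split; first split.
- have [N NE] : exists N : nat, d%:Z * (x - y) = N%:Z.
    by exists (absz (d%:Z * (x - y))); rewrite gez0_abs // mulr_ge0 // subr_ge0 ltW.
  exists N; split.
    by rewrite -ltz_nat -NE mulr_gt0 // subr_gt0.
  move=> v latv; rewrite pmulrn -NE; exact: line_proj_lattice.
- exact: line_proj_idem.
- exact: line_proj_selfadjoint.
- exact: range_line_proj.
- exact: range_line_coproj.
Qed.

Lemma period_map_split_locus (a b c e : nat) (u v : int) (Z : 'M[C]_2) :
  (0 < a)%N -> (0 < b)%N -> (0 < c)%N -> (0 < e)%N ->
  coprime a c -> coprime b c -> a%:Z * u - b%:Z * v = c%:Z -> siegel Z ->
  let x := (a * e)%N%:Z * u in let y := (b * e)%N%:Z * v in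
  Z 1 1 = (x + y)%:~R * Z 0 1 - (x * y)%:~R * Z 0 0 ->
  split_locus (a * b * e) (c * b * e) (c * a * e)
    (period_map (a * b * e) Z).
Proof.
move=> a_gt0 b_gt0 c_gt0 e_gt0 cop_ac cop_bc uvc sZ x y rel.
have rel' : Z 1 1 = (y + x)%:~R * Z 0 1 - (y * x)%:~R * Z 0 0.
  by rewrite [y + x]addrC [y * x]mulrC.
have xyE : x - y = e%:Z * c%:Z by rewrite -uvc /x /y !PoszM; ring.
(* As [a u = b v + c], a common divisor of [b] and [u] divides [c]. *)
have cop_bu : coprimez b u.
  have [[s t] /= bez] := coprimezP _ _ (cop_bc : coprimez b c).
  by apply/coprimezP; exists (s - t * v, t * a%:Z); rewrite /= -bez -uvc; ring.
have cop_av : coprimez a v.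
  have [[s t] /= bez] := coprimezP _ _ (cop_ac : coprimez a c).
  by apply/coprimezP; exists (s + t * u, - (t * b%:Z)); rewrite /= -bez -uvc; ring.
have d_gt0 : (0 < a * b * e)%N by rewrite !muln_gt0 a_gt0 b_gt0.
exists (std_surface (a * b * e) Z); split=> //; first exact: std_polarised.
exists (line x), (line y).
have lt_yx : y < x by rewrite -subr_gt0 xyE mulr_gt0.
have dEx : (a * b * e = a * e * b)%N by ring.
have dEy : (a * b * e = b * e * a)%N by ring.
split.
- by apply: (line_elliptic_curve b_gt0 dEx) rel; rewrite ?muln_gt0 ?a_gt0.
- by apply: (line_elliptic_curve a_gt0 dEy) rel'; rewrite ?muln_gt0 ?b_gt0.
- exact: lines_complementary.
- apply: (line_exponent b_gt0 dEx _ _ sZ rel) => //; first by rewrite muln_gt0 a_gt0.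
  by rewrite xyE !PoszM ger0_norm; [ring|rewrite !mulr_ge0].
- apply: (line_exponent a_gt0 dEy _ _ sZ rel') => //; first by rewrite muln_gt0 b_gt0.
  by rewrite -opprB xyE mulrN normrN !PoszM ger0_norm; [ring|rewrite !mulr_ge0].
Qed.

End Complement.

(** * Analytic functions on a segment *)

Section PowerSeries.
Variable K : numFieldType.
Implicit Types (c : nat -> K) (l : K -> K).

Definition pterm c (h : K) : nat -> K := fun n => c n * h ^+ n.

Lemma geometric_sum_le2 (q : K) n : 0 <= q -> q <= 2^-1 ->
  \sum_(i < n) q ^+ i <= 2.
Proof.
move=> q_ge0 q_le; have q_lt1 : q < 1.
  by apply: le_lt_trans q_le _; rewrite invf_lt1 // ltr1n.
have : (1 - q) * \sum_(i < n) q ^+ i <= 1.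
  by rewrite -opprB mulNr -subrX1 opprB gerBl exprn_ge0.
rewrite mulrC -ler_pdivlMr ?subr_gt0 // => /le_trans; apply.
rewrite mul1r invf_ple ?posrE ?subr_gt0 //.
by rewrite lerBrDl -lerBrDr; apply: le_trans q_le _;
  rewrite lerBrDr -mulr2n -[_ *+ 2]mulr_natr mulVf.
Qed.

(** Comparison with a geometric series: if the terms are bounded at [h0], the
    terms of positive degree at [h0 q] add up to [O(q)]. *)
Lemma pterm_tail_le c (h0 M q : K) n : 0 <= q -> q <= 2^-1 ->
  (forall k, `|pterm c h0 k| <= M) ->
  `|series (pterm c (h0 * q)) n.+1 - c 0| <= 2 * M * q.
Proof.
move=> q_ge0 q_le bM; have M_ge0 : 0 <= M := le_trans (normr_ge0 _) (bM 0).
rewrite seriesEord /= big_ord_recl {1}/pterm /= expr0 mulr1 addrAC subrr add0r.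
apply: (@le_trans _ _ (\sum_(i < n) M * q * q ^+ i)).
  apply: le_trans (ler_norm_sum _ _ _) _; apply: ler_sum => i _.
  rewrite /pterm /bump /= add1n exprMn mulrA normrM -(mulrA M) -exprS.
  by apply: ler_pM => //; [exact: bM | rewrite ger0_norm ?exprn_ge0].
rewrite -mulr_sumr mulrC -mulrA ler_wpM2r ?mulr_ge0 //.
exact: geometric_sum_le2.
Qed.

(** A power series is continuous at the centre of its disc.  In the complex
    numbers, where [0 < h] forces [h] to be real, this is one-sided continuity
    along the real axis, which is all that is needed on a segment. *)
Lemma pseries_cont0 c l (rho eps : K) : 0 < rho -> 0 < eps ->
  (forall h, 0 < h -> h < rho -> series (pterm c h) @ \oo --> (l h : K)) ->
  exists2 delta, 0 < delta & forall h, 0 < h -> h < delta ->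
    h < rho /\ `|l h - c 0| <= eps.
Proof.
move=> rho_gt0 eps_gt0 cvgl.
have h0_gt0 : 0 < rho / 2 by rewrite divr_gt0.
have h0_lt : rho / 2 < rho by rewrite ltr_pdivrMr // ltr_pMr // ltr1n.
have [M [M_gt0 bM]] : exists M, 0 < M /\ forall k, `|pterm c (rho / 2) k| <= M.
  have cvgs : cvgn (series (pterm c (rho / 2))).
    by apply/cvg_ex; exists (l (rho / 2)); exact: cvgl.
  have [M [M_real bM]] := cvg_seq_bounded (cvgP _ (cvg_series_cvg_0 cvgs)).
  exists (`|M| + 1); split; first by rewrite ltr_wpDl.
  by move=> k; apply: bM => //=; rewrite ltr_pwDr // real_ler_norm.
exists (rho / 2 * (eps / (2 * (2 * M + eps)))).
  by rewrite mulr_gt0 // divr_gt0 // mulr_gt0 // addr_gt0 // mulr_gt0.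
move=> h h_gt0 h_lt.
pose q := h / (rho / 2).
have hE : h = rho / 2 * q by rewrite /q mulrC divfK // gt_eqF.
have q_ge0 : 0 <= q by rewrite divr_ge0 // ltW.
have q_lt : q < eps / (2 * (2 * M + eps)).
  by rewrite /q ltr_pdivrMr // mulrC.
have D_gt0 : 0 < 2 * M + eps by rewrite addr_gt0 // mulr_gt0.
have q_le2 : q <= 2^-1.
  apply: ltW (lt_le_trans q_lt _); rewrite invfM mulrCA ler_piMr ?invr_ge0 //.
  by rewrite ler_pdivrMr // mul1r lerDr mulr_ge0 // ltW.
have qM_le : 2 * M * q <= eps / 2.
  apply: (@le_trans _ _ (2 * M * (eps / (2 * (2 * M + eps))))).
    by rewrite ler_wpM2l ?mulr_ge0 // ltW.
  rewrite [leLHS](_ : _ = eps / 2 * (2 * M / (2 * M + eps))); last first.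
    by field; rewrite gt_eqF.
  by rewrite ger_pMr ?divr_gt0 // ler_pdivrMr // mul1r lerDl ltW.
have h_lt_rho : h < rho.
  apply: lt_trans _ h0_lt; rewrite hE gtr_pMr //.
  by apply: le_lt_trans q_le2 _; rewrite invf_lt1 // ltr1n.
split=> //.
have /cvgrPdist_lt/(_ (eps / 2)) := cvgl h h_gt0 h_lt_rho.
rewrite divr_gt0 // => /(_ isT)[N _ /(_ N.+1 (leqnSn N))] /= lN.
rewrite -(subrK (series (pterm c h) N.+1) (l h)) -addrA [eps]splitr.
apply: le_trans (ler_normD _ _) _; apply: lerD; first exact: ltW.
by apply: le_trans qM_le; rewrite {1}hE; apply: pterm_tail_le.
Qed.

Lemma pseries_coef0_eq0 c (rho : K) : 0 < rho ->
  (forall h, 0 < h -> h < rho -> series (pterm c h) @ \oo --> (0 : K)) ->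
  c 0 = 0.
Proof.
move=> rho_gt0 cvg0; apply/eqP; rewrite -normr_eq0; apply/negPn/negP => c0_neq0.
have c0_gt0 : 0 < `|c 0| by rewrite lt_def c0_neq0 normr_ge0.
have [|delta delta_gt0] :=
    pseries_cont0 (l := fun=> 0) (eps := `|c 0| / 2) rho_gt0 _ cvg0.
  by rewrite divr_gt0.
have d2_gt0 : 0 < delta / 2 by rewrite divr_gt0.
have d2_lt : delta / 2 < delta by rewrite ltr_pdivrMr // ltr_pMr // ltr1n.
move=> /(_ _ d2_gt0 d2_lt)[_]; rewrite sub0r normrN ler_pdivlMr //.
by rewrite ger_pMr // lern1.
Qed.

(** If the constant coefficient vanishes, dividing by [h] gives a series of the
    same kind, so the coefficients vanish one after the other. *)
Lemma pseries_eq0 c (rho : K) : 0 < rho ->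
  (forall h, 0 < h -> h < rho -> series (pterm c h) @ \oo --> (0 : K)) ->
  forall n, c n = 0.
Proof.
move=> rho_gt0 cvg0 n; elim: n c cvg0 => [|n IHn] c cvg0.
  exact: pseries_coef0_eq0 cvg0.
have c0 := pseries_coef0_eq0 rho_gt0 cvg0.
apply: (IHn (fun k => c k.+1)) => h h_gt0 h_lt.
have -> : series (pterm (fun k => c k.+1) h)
    = (fun N => h^-1 * series (pterm c h) N.+1).
  apply/funext => N; rewrite !seriesEord /= big_ord_recl /pterm /= c0 mul0r add0r.
  rewrite mulr_sumr; apply: eq_bigr => i _.
  by rewrite /bump /= add1n exprS; field; rewrite gt_eqF.
rewrite -[X in _ --> X](mulr0 h^-1); apply: cvgM; first exact: cvg_cst.
by have := cvg0 h h_gt0 h_lt; rewrite -cvg_shiftS.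
Qed.

Lemma pseries_at0 c (l : K) : series (pterm c 0) @ \oo --> l -> l = c 0.
Proof.
move=> cvgl; suff cvgc : series (pterm c 0) @ \oo --> (c 0 : K).
  exact: (cvg_unique (@norm_hausdorff _ K) cvgl cvgc).
rewrite -(cvg_shiftS (series (pterm c 0))) /=.
rewrite (_ : (fun n => _) = fun=> c 0); first exact: cvg_cst.
apply/funext => n; rewrite seriesEord /= big_ord_recl /pterm /= expr0 mulr1.
by rewrite big1 ?addr0 // => i _; rewrite expr0n mulr0.
Qed.

End PowerSeries.

Section Segment.
Variable R : realType.
Local Notation C := (R[i]).

(* [C] with the topology given by its norm. *)
Local Notation CT := (C : numFieldType).

Definition real_analytic (g : R -> C) (s : R) : Prop :=
  exists (rho : R) (c : nat -> C), 0 < rho /\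
    forall t : R, `|t| < rho ->
      (series (pterm c t%:C) : nat -> CT) @ \oo --> (g (s + t) : CT).

Lemma pos_real (h : C) (r : R) : 0 < h -> h < r%:C ->
  exists2 t, h = t%:C & 0 < t < r.
Proof.
case: h => a b; rewrite !ltcE /= => /andP[/eqP -> a_gt0] /andP[_ a_lt].
by exists a => //; rewrite a_gt0.
Qed.

Lemma real_analytic_neq0 (f : R -> C) (s : R) : real_analytic f s -> f s != 0 ->
  exists2 delta, 0 < delta & forall t, 0 <= t < delta -> f (s + t) != 0.
Proof.
move=> [rho [c [rho_gt0 cvgf]]] fs_neq0.
have c0 : f s = c 0.
  apply: pseries_at0; have := cvgf 0; rewrite normr0 addr0 => /(_ rho_gt0).
  by rewrite rmorph0.
have eps_gt0 : 0 < `|f s| / 2 by rewrite divr_gt0 ?normr_gt0.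
have rhoC_gt0 : 0 < rho%:C by rewrite ltcR.
have [|delta delta_gt0 near_c0] :=
    @pseries_cont0 CT c (fun h => f (s + complex.Re h)) _ _ rhoC_gt0 eps_gt0.
  move=> h h_gt0 h_lt; have [t -> /andP[t_gt0 t_lt]] := pos_real h_gt0 h_lt.
  by apply: cvgf; rewrite gtr0_norm.
have deltaE : delta = (complex.Re delta)%:C.
  by move: delta_gt0; case: (delta) => a b; rewrite ltcE /= => /andP[/eqP -> _].
exists (complex.Re delta); first by rewrite -ltcR -deltaE.
move=> t /andP[]; rewrite le_eqVlt => /orP[/eqP <- _|t_gt0 t_lt].
  by rewrite addr0.
have [||_ /=] := near_c0 t%:C; first by rewrite ltcR.
  by rewrite deltaE ltcR.
rewrite -c0; apply: contraTneq => ->; rewrite sub0r normrN.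
rewrite ler_pdivlMr // ger_pMr ?normr_gt0 //.
by rewrite lern1.
Qed.

(** The expansion at [s], read in the variable [- t], is a power series that
    vanishes for small positive values; all its coefficients are therefore zero,
    and [g] vanishes on the other side of [s] as well. *)
Lemma real_analytic_eq0 (g : R -> C) (s : R) : real_analytic g s ->
  (exists2 delta, 0 < delta & forall t, - delta < t < 0 -> g (s + t) = 0) ->
  exists2 delta, 0 < delta & forall t, `|t| < delta -> g (s + t) = 0.
Proof.
move=> [rho [c [rho_gt0 cvgg]]] [delta delta_gt0 g0].
pose m := Num.min rho delta.
have m_gt0 : 0 < m by rewrite lt_min rho_gt0.
have mC_gt0 : 0 < m%:C by rewrite ltcR.
have c0 n : c n = 0.
  suff : c n * (-1) ^+ n = 0.
    by move/eqP; rewrite mulf_eq0 signr_eq0 orbF => /eqP.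
  apply: (@pseries_eq0 CT (fun n => c n * (-1) ^+ n) _ mC_gt0) => h h_gt0 h_lt.
  have [t -> /andP[t_gt0]] := pos_real h_gt0 h_lt.
  rewrite lt_min => /andP[t_rho t_delta].
  rewrite (_ : pterm _ _ = pterm c (- t)%:C); last first.
    by apply/funext => k; rewrite /pterm rmorphN [in RHS]exprNn mulrA.
  have := cvgg (- t); rewrite normrN gtr0_norm // => /(_ t_rho).
  by rewrite g0 // ltrN2 t_delta oppr_lt0.
exists rho => // t /cvgg; rewrite (_ : series _ = fun=> 0).
  by move/(cvg_unique (@norm_hausdorff _ CT)) => /(_ _ (cvg_cst _)).
apply/funext => k; rewrite seriesEord /= big1 // => i _.
by rewrite /pterm c0 mul0r.
Qed.

(** Near [0] the factor [f] does not vanish, so [g] does.  This propagates to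
    [1]: at the supremum of the [t] such that [g = 0] on [[0, t]], the function
    [g] vanishes on the left, hence also on the right, so the supremum is [1]
    and it is attained. *)
Lemma segment_mul_eq0 (f g : R -> C) :
  (forall s, 0 <= s <= 1 -> real_analytic f s) ->
  (forall s, 0 <= s <= 1 -> real_analytic g s) ->
  (forall s, 0 <= s <= 1 -> f s * g s = 0) -> f 0 != 0 -> g 1 = 0.
Proof.
move=> anf ang fg0 f0_neq0.
have [|delta delta_gt0 f_neq0] := real_analytic_neq0 (anf 0 _) f0_neq0.
  by rewrite lexx ler01.
pose E : set R := [set t | 0 <= t <= 1 /\ forall s, 0 <= s <= t -> g s = 0].
pose t0 := Num.min 1 (delta / 2).
have t0_gt0 : 0 < t0 by rewrite lt_min ltr01 divr_gt0.
have Et0 : E t0.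
  split; first by rewrite ltW //= ge_min lexx.
  move=> s /andP[s_ge0]; rewrite le_min => /andP[s_le1 s_le].
  have fs : f s != 0.
    rewrite -[s]add0r; apply: f_neq0; rewrite s_ge0 /=.
    by apply: le_lt_trans s_le _; rewrite ltr_pdivrMr // ltr_pMr // ltr1n.
  have := fg0 s; rewrite s_ge0 s_le1 => /(_ isT)/eqP.
  by rewrite mulf_eq0 (negPf fs) => /eqP.
have supE : has_sup E.
  by split; [exists t0 | exists 1 => t [/andP[]]].
pose s := sup E.
have s_ge : t0 <= s by exact: sup_upper_bound.
have s_le1 : s <= 1 by apply: sup_le_ub => [|t [/andP[]]//]; exists t0.
have s_gt0 : 0 < s := lt_le_trans t0_gt0 s_ge.
have g0_lt t : 0 <= t < s -> g t = 0.
  move=> /andP[t_ge0 t_lt].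
  have st_gt0 : 0 < s - t by rewrite subr_gt0.
  have [e [_ g0e]] := sup_adherent st_gt0 supE.
  by rewrite -/s subKr => lte; apply: g0e; rewrite t_ge0 ltW.
have [||d' d'_gt0 g0_near] := real_analytic_eq0 (ang s _).
- by rewrite s_le1 ltW.
- exists s => // t /andP[t_gt t_lt]; apply: g0_lt.
  by rewrite addrC -lerBlDr sub0r ltW //= gtrDr.
pose t1 := Num.min 1 (s + d' / 2).
have Et1 : E t1.
  split; first by rewrite le_min ler01 addr_ge0 ?ge_min ?lexx // ltW ?divr_gt0.
  move=> t /andP[t_ge0]; rewrite le_min => /andP[_ t_le].
  have [t_lt|t_ge] := ltP t s; first by rewrite g0_lt // t_ge0.
  rewrite -[t](subrKC s); apply: g0_near; rewrite ger0_norm ?subr_ge0 //.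
  rewrite ltrBlDl; apply: le_lt_trans t_le _.
  by rewrite ltrD2l ltr_pdivrMr // ltr_pMr // ltr1n.
have : t1 <= s by exact: sup_upper_bound.
rewrite ge_min gerDl [_ <= 0]leNgt divr_gt0 //= orbF => s_ge1.
have -> : 1 = t1.
  rewrite /t1 min_l //; apply: le_trans s_ge1 _; rewrite lerDl ltW //.
  by rewrite divr_gt0.
by apply: Et1.2; rewrite lexx andbT le_min ler01 addr_ge0 // ltW // divr_gt0.
Qed.

End Segment.

(** * Irreducibility of images of convex sets *)

Section Components.
Variable R : realType.
Local Notation C := (R[i]).

Definition segment (Z1 Z2 : 'M[C]_2) (s : R) : 'M[C]_2 :=
  Z1 + s%:C *: (Z2 - Z1).

Lemma segment0 (Z1 Z2 : 'M[C]_2) : segment Z1 Z2 0 = Z1.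
Proof. by rewrite /segment rmorph0 scale0r addr0. Qed.

Lemma segment1 (Z1 Z2 : 'M[C]_2) : segment Z1 Z2 1 = Z2.
Proof. by rewrite /segment rmorph1 scale1r subrKC. Qed.

Lemma segmentE (Z1 Z2 : 'M[C]_2) s i j :
  segment Z1 Z2 s i j = Z1 i j + s%:C * (Z2 i j - Z1 i j).
Proof. by rewrite !mxE. Qed.

Definition mx_convex (S : set 'M[C]_2) : Prop :=
  forall Z1 Z2 s, S Z1 -> S Z2 -> 0 <= s <= 1 -> S (segment Z1 Z2 s).

Lemma siegel_convex : mx_convex (@siegel R).
Proof.
move=> Z1 Z2 s [sym1 pos1] [sym2 pos2] /andP[s_ge0 s_le1]; split.
  by rewrite /segment linearD linearZ linearB /= sym1 sym2.
move=> v v_neq0.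
have -> : im_mx (segment Z1 Z2 s) = (1 - s) *: im_mx Z1 + s *: im_mx Z2.
  apply/matrixP => i j; rewrite !mxE raddfD /= Im_cmul raddfB /=; ring.
rewrite mulmxDr mulmxDl -!scalemxAr -!scalemxAl.
have := pos1 v v_neq0; have := pos2 v v_neq0.
move: (_ *m _ *m v) (_ *m im_mx Z1 *m v) => q2 q1; rewrite !mxE.
move: s_ge0; rewrite le_eqVlt => /orP[/eqP <- _ p1|s_gt0 p2 p1].
  by rewrite subr0 mul1r mul0r addr0.
by rewrite ltr_wpDl ?mulr_gt0 // mulr_ge0 ?subr_ge0 // ltW.
Qed.

Lemma homog_part_scale (a : nat -> nat -> nat -> C) (t k1 k2 k3 : C) n :
  homog_part a (t * k1) (t * k2) (t * k3) n = homog_part a k1 k2 k3 n * t ^+ n.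
Proof.
rewrite /homog_part mulr_suml; apply: eq_bigr => i _.
rewrite mulr_suml; apply: eq_bigr => j _.
have nE : n = (i + j + (n - i - j))%N.
  by rewrite -subnDA subnKC // -[leqRHS](subnKC (ltn_ord i : (i <= n)%N)) leq_add2l -ltnS.
by rewrite [X in _ = _ * t ^+ X]nE !exprMn !exprD; ring.
Qed.

(** On the line [Z + t K] the homogeneous part of degree [n] of a power series
    in the entries of [t K] is a multiple of [t ^+ n]. *)
Lemma holomorphic_segment (f : 'M[C]_2 -> C) (Z1 Z2 : 'M[C]_2) (s : R) :
  holomorphic f -> siegel Z1 -> siegel Z2 -> 0 <= s <= 1 ->
  real_analytic (fun t => f (segment Z1 Z2 t)) s.
Proof.
move=> hol_f sZ1 sZ2 s01.
have [r [a [r_gt0 expand]]] := hol_f _ (siegel_convex sZ1 sZ2 s01).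
pose k1 := Z2 0 0 - Z1 0 0; pose k2 := Z2 0 1 - Z1 0 1.
pose k3 := Z2 1 1 - Z1 1 1.
pose B := 1 + complex.Re `|k1| + complex.Re `|k2| + complex.Re `|k3|.
have normE (k : C) : `|k| = (complex.Re `|k|)%:C by rewrite RRe_real ?normr_real.
have Re_ge0 (k : C) : 0 <= complex.Re `|k| by rewrite -ler0c -normE.
have B_gt0 : 0 < B.
  by rewrite /B; have := Re_ge0 k1; have := Re_ge0 k2; have := Re_ge0 k3; lra.
exists (r / B), (homog_part a k1 k2 k3); split; first by rewrite divr_gt0.
move=> t t_lt.
have tk_lt (k : C) : complex.Re `|k| <= B -> `|t%:C * k| < r%:C.
  move=> k_le; rewrite normrM [`|k|]normE.
  rewrite (_ : `|t%:C| = `|t|%:C); last first.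
    by rewrite normc_def /= expr0n addr0 sqrtr_sqr.
  rewrite -rmorphM ltcR; apply: (@le_lt_trans _ _ (`|t| * B)).
    by rewrite ler_wpM2l.
  by rewrite -ltr_pdivlMr.
have [||| _] := expand (t%:C * k1) (t%:C * k2) (t%:C * k3).
- by apply: tk_lt; rewrite /B; have := Re_ge0 k2; have := Re_ge0 k3; lra.
- by apply: tk_lt; rewrite /B; have := Re_ge0 k1; have := Re_ge0 k3; lra.
- by apply: tk_lt; rewrite /B; have := Re_ge0 k1; have := Re_ge0 k2; lra.
rewrite (_ : homog_part a _ _ _ = pterm (homog_part a k1 k2 k3) t%:C); last first.
  by apply/funext => n; rewrite homog_part_scale.
rewrite (_ : _ + sym2 _ _ _ = segment Z1 Z2 (s + t)) //.
have /siegelP[sym1 _ _] := sZ1; have /siegelP[sym2 _ _] := sZ2.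
apply/matrixP => i j; rewrite [LHS]mxE !segmentE rmorphD mxE /k1 /k2 /k3.
by case: (ord2P i) => ->; case: (ord2P j) => -> /=; rewrite ?sym1 ?sym2; ring.
Qed.

Definition period_image (d : nat) (S : set 'M[C]_2) : set (set (torus_form R)) :=
  [set period_map d Z | Z in S].

Lemma period_image_irreducible (d : nat) (S : set 'M[C]_2) : (0 < d)%N ->
  S `<=` @siegel R -> S !=set0 -> mx_convex S -> irreducible d (period_image d S).
Proof.
move=> d_gt0 S_siegel [Z0 SZ0] S_convex; split.
- move=> _ [Z SZ <-]; exists (std_surface d Z); split=> //.
  exact: std_polarised (S_siegel _ SZ).
- by exists (period_map d Z0), Z0.
move=> Y1 Y2 [_ [S1 [mod1 Y1E]]] [_ [S2 [mod2 Y2E]]] cover.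
have [|not_sub1] := pselect (period_image d S `<=` Y1); [by left | right].
have [Z1 [f [SZ1 S1f f_neq0]]] : exists Z1 f, [/\ S Z1, S1 f & f Z1 != 0].
  apply: contrapT => no_f; apply: not_sub1 => _ [Z SZ <-].
  apply/(Y1E _ (S_siegel _ SZ)) => f S1f; apply/eqP/negPn/negP => fZ.
  by apply: no_f; exists Z, f.
move=> _ [Z2 SZ2 <-]; apply/(Y2E _ (S_siegel _ SZ2)) => g S2g.
have [kf [hol_f _]] := mod1 f S1f; have [kg [hol_g _]] := mod2 g S2g.
have an (h : 'M[C]_2 -> C) : holomorphic h -> forall s, 0 <= s <= 1 ->
    real_analytic (fun t => h (segment Z1 Z2 t)) s.
  by move=> hol_h s s01; apply: holomorphic_segment (S_siegel _ _) (S_siegel _ _) _.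
rewrite -(segment1 Z1 Z2).
apply: (segment_mul_eq0 (an f hol_f) (an g hol_g)); last by rewrite segment0.
move=> s s01; have SZ := S_convex _ _ _ SZ1 SZ2 s01.
have [Y1Z|Y2Z] := cover _ (ex_intro2 _ _ _ SZ erefl).
  by rewrite ((Y1E _ (S_siegel _ SZ)).1 Y1Z f S1f) mul0r.
by rewrite ((Y2E _ (S_siegel _ SZ)).1 Y2Z g S2g) mulr0.
Qed.

(** * Irreducible components *)

(** Zorn's lemma is applied to the sets [X] such that [X0 `|` X] is irreducible
    and contained in [E], rather than to the [X] that contain [X0], so that the
    empty chain is no exception. *)
Lemma irreducible_sub_component (d : nat) (E X0 : set (set (torus_form R))) :
  X0 `<=` E -> irreducible d X0 ->
  exists2 X, irreducible_component d E X & X0 `<=` X.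
Proof.
move=> X0E X0_irr.
pose P : set (set (set (torus_form R))) :=
  [set X | X0 `|` X `<=` E /\ irreducible d (X0 `|` X)].
have [F PF totF|X [[XE X_irr] X_max]] := @Zorn_bigcup _ P; last first.
  exists (X0 `|` X); last by move=> p; left.
  split=> // Y Y_irr XY YE; apply/seteqP; split=> // p Yp.
  apply: contrapT => not_Xp; apply: (X_max Y).
    split; first by move=> q Xq; apply: XY; right.
    by move=> /(_ p Yp) Xp; apply: not_Xp; right.
  have X0Y : X0 `|` Y = Y.
    by apply/seteqP; split=> q; [case=> // X0q; apply: XY; left | right].
  by split; rewrite X0Y.
have [X0_mod [p0 X0p0] X0_prime] := X0_irr.
split=> [p [/X0E//|[X FX Xp]]|]; first by apply: (PF X FX).1; right.
split.
- move=> p [/X0_mod//|[X FX Xp]].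
  by have [_ [X_mod _ _]] := PF X FX; apply: X_mod; right.
- by exists p0; left.
move=> Y1 Y2 cl1 cl2 cover.
apply: contrapT => /not_orP[not1 not2].
have [p [Up not1p]] : exists p, (X0 `|` \bigcup_(X in F) X) p /\ ~ Y1 p.
  apply: contrapT => no_p; apply: not1 => p Up; apply: contrapT => not1p.
  by apply: no_p; exists p.
have [q [Uq not2q]] : exists q, (X0 `|` \bigcup_(X in F) X) q /\ ~ Y2 q.
  apply: contrapT => no_q; apply: not2 => q Uq; apply: contrapT => not2q.
  by apply: no_q; exists q.
(* A member of the chain, or the empty set, that catches both [p] and [q]. *)
have [X [X_irr XU [Xp Xq]]] : exists X, [/\ irreducible d (X0 `|` X),
    X `<=` \bigcup_(X in F) X & (X0 `|` X) p /\ (X0 `|` X) q].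
  case: Up => [X0p|[Xp FXp Xpp]]; case: Uq => [X0q|[Xq FXq Xqq]].
  - by exists set0; rewrite setU0; split=> //; exact: sub0set.
  - exists Xq; split; [exact: (PF _ FXq).2 | by move=> z; exists Xq |].
    by split; [left | right].
  - exists Xp; split; [exact: (PF _ FXp).2 | by move=> z; exists Xp |].
    by split; [right | left].
  - have [sub|sub] := totF _ _ FXp FXq.
      exists Xq; split; [exact: (PF _ FXq).2 | by move=> z; exists Xq |].
      by split; right => //; apply: sub.
    exists Xp; split; [exact: (PF _ FXp).2 | by move=> z; exists Xp |].
    by split; right => //; apply: sub.
have [_ _ X_prime] := X_irr.
have [|sub1|sub2] := X_prime _ _ cl1 cl2.
- by move=> z [X0z|Xz]; apply: cover; [left | right; apply: XU].
- by apply: not1p; apply: sub1.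
- by apply: not2q; apply: sub2.
Qed.

(** * The locus of a singular relation *)

Definition split_period_locus (x y : int) : set 'M[C]_2 :=
  [set Z | siegel Z /\
           Z 1 1 = (x + y)%:~R * Z 0 1 - (x * y)%:~R * Z 0 0].

Lemma split_period_locus_convex (x y : int) : mx_convex (split_period_locus x y).
Proof.
move=> Z1 Z2 s [sZ1 rel1] [sZ2 rel2] s01; split; first exact: siegel_convex.
by rewrite !segmentE rel1 rel2; ring.
Qed.

(** For [Im Z] with first row [(1, h)] the relation makes the determinant equal
    to [- (h - x) (h - y)], which is largest, and positive, at the midpoint
    [h = (x + y) / 2]. *)
Lemma split_period_locus_neq0 (x y : int) : y < x -> split_period_locus x y !=set0.
Proof.
move=> lt_yx; pose h : R := (x + y)%:~R / 2.
exists (map_mx (fun r : R => 0 +i* r) (\matrix_(i, j)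
  if i != j then h else if i == 0 then 1 else (x + y)%:~R * h - (x * y)%:~R)).
split; last by rewrite !mxE /= !intr_complex; simpc.
apply/siegelP; split; rewrite ?mxE //= ?ltr01 // /det_im !mxE /=.
rewrite (_ : _ - _ = ((x - y)%:~R / 2) ^+ 2); last first.
  by rewrite /h !(rmorphM, rmorphD, rmorphB) /=; field.
by rewrite exprn_gt0 // divr_gt0 // ltr0z subr_gt0.
Qed.

End Components.

Theorem theorem6p4 (R : realType) (d m n : nat)
  (d_gt0 : (0 < d)%N) (m_gt0 : (0 < m)%N) (n_gt0 : (0 < n)%N)
  (hlcm : (lcmn m n * gcdn (gcdn m n) d = gcdn m n * d)%N) :
  (exists a b c : nat, admissible d m n a b c) /\
  forall a b c : nat, admissible d m n a b c ->
    (exists u v : int, a%:Z * u - b%:Z * v = c%:Z) /\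
    forall u v : int, a%:Z * u - b%:Z * v = c%:Z ->
      exists x y : int,
        [/\ x%:~R = d%:R * u%:~R / b%:R :> rat,
            y%:~R = d%:R * v%:~R / a%:R :> rat,
            (d%:Z %| x * y)%Z,
            exists s : singular_relation,
              (forall Z : 'M[R[i]]_2, singular_lhs d s Z =
                 Z 1 1 - ((x + y)%:~R * Z 0 1 - (x * y)%:~R * Z 0 0)) /\
              (discriminant d s)%:~R = ((c * d)%:R / (a * b)%:R) ^+ 2 :> rat
          & exists X : set (set (torus_form R)),
              irreducible_component d (split_locus d m n) X /\
              forall Z : 'M[R[i]]_2, siegel Z ->
                Z 1 1 = (x + y)%:~R * Z 0 1 - (x * y)%:~R * Z 0 0 ->
                X (period_map d Z)].
Proof.
split; first exact: admissible_exists.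
move=> a b c adm; have [[a_gt0 b_gt0 c_gt0] [cop_ab cop_ac cop_bc] _ _] := adm.
have [e e_gt0 [dE mE nE]] := admissible_param d_gt0 adm; split.
  have [[s t] /= bez] := coprimezP _ _ (cop_ab : coprimez a b).
  by exists (c%:Z * s), (- (c%:Z * t)); rewrite -[RHS]mulr1 -bez; ring.
move=> u v uvc; pose x := (a * e)%N%:Z * u; pose y := (b * e)%N%:Z * v.
have xyE : x - y = e%:Z * c%:Z by rewrite -uvc /x /y !PoszM; ring.
have a_neq0 : a%:R != 0 :> rat by rewrite pnatr_eq0 -lt0n.
have b_neq0 : b%:R != 0 :> rat by rewrite pnatr_eq0 -lt0n.
have dxyE : x * y = d%:Z * (e%:Z * u * v).
  by rewrite /x /y dE !PoszM; ring.
exists x, y; split.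
- rewrite /x rmorphM /= -pmulrn dE !natrM; by field.
- rewrite /y rmorphM /= -pmulrn dE !natrM; by field.
- by rewrite dxyE dvdz_mulr.
- have prim : gcdz (e%:Z * u * v) (gcdz (- (x + y)) (gcdz 1 (gcdz 0 0))) = 1.
    by rewrite gcd1z !gcdz1.
  exists (SingularRelation prim); split.
    move=> Z; rewrite /singular_lhs /= dxyE.
    by rewrite !(rmorphN, rmorphM, rmorphD, rmorph0, rmorph1) /= -!pmulrn; ring.
  rewrite /discriminant /= (_ : _ - _ = (e%:Z * c%:Z) ^+ 2); last first.
    transitivity ((x + y) ^+ 2 - 4 * (d%:Z * (e%:Z * u * v))); first by ring.
    by rewrite -dxyE -xyE; ring.
  rewrite rmorphXn rmorphM /= -!pmulrn dE !natrM; congr (_ ^+ 2).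
  by field; rewrite ?a_neq0 ?b_neq0.
have lt_yx : y < x by rewrite -subr_gt0 xyE mulr_gt0.
pose S := @split_period_locus R x y.
have [||X X_comp SX] := @irreducible_sub_component R d (split_locus d m n)
    (period_image d S).
- move=> _ [Z [sZ rel] <-]; rewrite mE nE dE.
  exact: (@period_map_split_locus R a b c e u v).
- apply: period_image_irreducible => //; first by move=> Z [].
    exact: split_period_locus_neq0.
  exact: split_period_locus_convex.
by exists X; split=> // Z sZ rel; apply: SX; exists Z.
Qed.
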